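(* The allocation problem with global utility maximization is NP-hard. That is, the following problem is NP-hard: given positive integers $m\le n$ and a utility function $U:\mathcal N\to\mathbb R$ on the set $\mathcal N$ of perfect matchings of the complete bipartite graph with vertex classes $V_1$, $|V_1|=m$, and $V_2$, $|V_2|=n$, where $U(M)$ can be computed in time polynomial in $m$ for every $M\in\mathcal N$, find a perfect matching $M^*\in\arg\max_{M\in\mathcal N}U(M)$.
   Context: The complete bipartite graph $G=(V_1\cup V_2,E)$ has $E=V_1\times V_2$. A matching is a set of edges no two of which share an endpoint. A perfect matching is a matching $M$ such that $M\cup\{(i,j)\}$ is not a matching for any edge $(i,j)\notin M$; since $m\le n$, this means every vertex of $V_1$ lies in exactly one edge of $M$, so $|M|=m$. No structure is assumed on $U$ beyond polynomial-time computability of $U(M)$ for a given $M$. *)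

(* Defs.v *)
From HB Require Import structures.
From mathcomp Require Import all_boot all_order all_algebra.
From mathcomp Require Import reals.

Set Implicit Arguments.
Unset Strict Implicit.
Unset Printing Implicit Defensive.

Import Order.TTheory GRing.Theory Num.Theory.

(** * Machine model

  Deterministic machines with finitely many one-ended tapes (stacks) over the
  alphabet {0, 1, #}, with a structured finite control.  An elementary step
  reads, writes or erases one symbol, so the model is a multitape Turing
  machine up to a polynomial overhead: a Turing tape is a pair of stacks, and
  conversely.  In particular t steps produce at most t new symbols. *)

Inductive sym := Bit (b : bool) | Sep.

Inductive cmd :=
  | Skip
  | Push (x : nat) (a : sym)
  | Pop (x : nat)
  | Query (x : nat)
  | Seq (c1 c2 : cmd)
  | Case (x : nat) (c_empty c_0 c_1 c_sep : cmd)
  | While (x : nat) (c : cmd).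

Definition store := nat -> seq sym.

Definition upd (s : store) (x : nat) (v : seq sym) : store :=
  fun y => if y == x then v else s y.

Definition branch (v : seq sym) (c_empty c_0 c_1 c_sep : cmd) : cmd :=
  match v with
  | [::] => c_empty
  | Bit false :: _ => c_0
  | Bit true :: _ => c_1
  | Sep :: _ => c_sep
  end.

(* [exec O c s t s']: with the oracle O, the program c takes the store s to the
   store s' in exactly t steps.  [Query x] replaces the word on the stack x by
   the answer of the oracle, and is charged for the length of both, so that the
   bound on the number of symbols also holds in the presence of an oracle. *)
Inductive exec (O : seq sym -> seq sym) : cmd -> store -> nat -> store -> Prop :=
  | ExecSkip s : exec O Skip s 1 s
  | ExecPush s x a : exec O (Push x a) s 1 (upd s x (a :: s x))
  | ExecPop s x : exec O (Pop x) s 1 (upd s x (behead (s x)))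
  | ExecQuery s x :
      exec O (Query x) s (size (s x) + size (O (s x))).+1 (upd s x (O (s x)))
  | ExecSeq c1 c2 s t1 s1 t2 s2 :
      exec O c1 s t1 s1 -> exec O c2 s1 t2 s2 ->
      exec O (Seq c1 c2) s (t1 + t2) s2
  | ExecCase x c_empty c_0 c_1 c_sep s t s' :
      exec O (branch (s x) c_empty c_0 c_1 c_sep) s t s' ->
      exec O (Case x c_empty c_0 c_1 c_sep) s t.+1 s'
  | ExecWhileEnd x c s :
      s x = [::] -> exec O (While x c) s 1 s
  | ExecWhileStep x c s t1 s1 t2 s2 :
      s x <> [::] -> exec O c s t1 s1 -> exec O (While x c) s1 t2 s2 ->
      exec O (While x c) s (t1 + t2).+1 s2.

(* Started with the words [args] on the stacks 0, 1, ... and all other stacks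
   empty, c halts within t steps with the word [out] on the stack 0. *)
Definition runs (O : seq sym -> seq sym) (c : cmd) (args : seq (seq sym))
    (t : nat) (out : seq sym) : Prop :=
  exists t' s', [/\ exec O c (nth [::] args) t' s', t' <= t & s' 0 = out].

(* Computation without oracle; here [Query x] merely empties the stack x. *)
Definition no_oracle : seq sym -> seq sym := fun=> [::].

(** * NP and NP-hardness of search problems *)

Definition bits (x : seq bool) : seq sym := map Bit x.

Definition NP (L : seq bool -> Prop) : Prop :=
  exists (V : seq bool -> seq bool -> bool) (v : cmd) (p q : {poly nat}),
    (forall x w, runs no_oracle v [:: bits x; bits w]
                   p.[size x + size w]%R [:: Bit (V x w)]) /\
    (forall x, L x <-> exists2 w, size w <= q.[size x]%R & V x w).

(* A search problem relates an instance to its solutions; the words that have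
   no solution are not instances, and no requirement is made on them. *)
Definition search_problem := seq sym -> seq sym -> Prop.

Definition solves (O : seq sym -> seq sym) (P : search_problem) : Prop :=
  forall q, (exists a, P q a) -> P q (O q).

(* Every language in NP reduces to P by a polynomial-time Turing reduction. *)
Definition NP_hard (P : search_problem) : Prop :=
  forall L, NP L -> exists (c : cmd) (p : {poly nat}),
    forall O, solves O P -> forall x, exists2 b : bool,
      runs O c [:: bits x] p.[size x]%R [:: Bit b] & b <-> L x.

(** * Matchings of the complete bipartite graph on 'I_m and 'I_n *)

Definition matching m n (M : {set 'I_m * 'I_n}) : bool :=
  [forall e in M, forall f in M, (e != f) ==> (e.1 != f.1) && (e.2 != f.2)].

Definition perfect m n (M : {set 'I_m * 'I_n}) : bool :=
  matching M && [forall e, (e \notin M) ==> ~~ matching (e |: M)].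

Definition perfect_matching m n := {M : {set 'I_m * 'I_n} | perfect M}.

(** * Encodings *)

(* Binary expansion, least significant digit first; 0 is written 0. *)
Definition bin (k : nat) : seq sym :=
  mkseq (fun i => Bit (odd (k %/ 2 ^ i))) (trunc_log 2 k).+1.

Definition unary (k : nat) : seq sym := nseq k (Bit true).

Definition enc_rat (r : rat) : seq sym :=
  Bit (r < 0)%R :: bin `|numq r|%N ++ Sep :: bin `|denq r|%N.

Definition enc_matching m n (M : perfect_matching m n) : seq sym :=
  flatten [seq bin (nat_of_ord e.1) ++ Sep :: bin (nat_of_ord e.2) ++ [:: Sep]
          | e <- enum (sval M)].

(* Polish notation, each constructor being announced by three bits. *)
Definition tag (b2 b1 b0 : bool) : seq sym := bits [:: b2; b1; b0].

Fixpoint enc_cmd (c : cmd) : seq sym :=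
  match c with
  | Skip => tag false false false
  | Push x a => tag false false true ++ bin x ++ [:: Sep; a]
  | Pop x => tag false true false ++ bin x ++ [:: Sep]
  | Query x => tag false true true ++ bin x ++ [:: Sep]
  | Seq c1 c2 => tag true false false ++ enc_cmd c1 ++ enc_cmd c2
  | Case x c_empty c_0 c_1 c_sep =>
      tag true false true ++ bin x ++ Sep :: enc_cmd c_empty ++
      enc_cmd c_0 ++ enc_cmd c_1 ++ enc_cmd c_sep
  | While x c1 => tag true true false ++ bin x ++ Sep :: enc_cmd c1
  end.

(* The numbers of vertices are written in unary: the size of an instance is at
   least the size of the graph, and polynomial in m is polynomial in the size
   of the instance. *)
Definition enc_instance (m n : nat) (u : cmd) : seq sym :=
  unary m ++ Sep :: unary n ++ Sep :: enc_cmd u.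

(** * The allocation problem *)

(* u computes U(M) from M in at most t steps; a computed real number has to be
   written down, here as a fraction. *)
Definition computes_utility (R : realType) m n (u : cmd)
    (U : perfect_matching m n -> R) (t : nat) : Prop :=
  forall M, exists2 r : rat,
    U M = ratr r & runs no_oracle u [:: enc_matching M] t (enc_rat r).

(* The utility function is part of the instance, where it is given by a program
   u that evaluates it at any M within p(m) steps.  The polynomial p is uniform
   over the instances: for a single m any time bound is polynomial. *)
Definition allocation (R : realType) (p : {poly nat}) : search_problem :=
  fun q a =>
    exists (m n : nat) (U : perfect_matching m n -> R) (u : cmd)
           (Mopt : perfect_matching m n),
      [/\ 0 < m <= n,
          computes_utility u U p.[m]%R,
          q = enc_instance m n u,
          forall M, (U M <= U Mopt)%R &
          a = enc_matching Mopt].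

(* Main.v *)
(* A generic reduction, without a Cook-Levin theorem: the utility program may
   contain any verifier.  Let V verify L with witnesses of size at most k = q(|x|).
   In the complete bipartite graph with n = 4m, the matching that joins every
   vertex i to 4i + 2b_i + e_i (b_i and e_i bits) codes the reverse of the word of those b_i for
   which e_i = 1, so that every word of size at most k <= m is coded by a perfect
   matching.  The utility of M is the bit V(x, w), where w is read off the first k
   edges of M, whatever M is; its maximum is 1 iff x is in L.  The time bound on
   the utility programs has to be one polynomial for all of NP: m is chosen so
   large, polynomially in |x|, that it dominates the running time of V.  The
   reduction evaluates the utility of the matching given by the oracle. *)

Require Import Defs.
From mathcomp Require Import all_boot all_order all_algebra.
From mathcomp Require Import boolp reals zify.

Import Order.TTheory GRing.Theory Num.Theory.

(** * Executions *)

(** Bounding the number of steps instead of fixing it lets worst-case estimates compose. *)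
Definition run (O : seq sym -> seq sym) (c : cmd) (s : store) (t : nat)
    (s' : store) : Prop :=
  exists2 t', t' <= t & exec O c s t' s'.

Definition st (l : seq (seq sym)) : store := nth [::] l.

Lemma upd_st (l : seq (seq sym)) x v : upd (st l) x v = st (set_nth [::] l x v).
Proof. by apply: funext => y; rewrite /upd /st nth_set_nth. Qed.

Lemma run_le {O c s t1 t2 s'} : run O c s t1 s' -> t1 <= t2 -> run O c s t2 s'.
Proof. by case=> t lt H h; exists t => //; apply: leq_trans h. Qed.

Lemma run_eq {O c s t s1 s2} : run O c s t s1 -> s1 =1 s2 -> run O c s t s2.
Proof. by move=> H /funext <-. Qed.

Lemma run_seq {O c1 c2 s t1 s1 t2 s2} :
  run O c1 s t1 s1 -> run O c2 s1 t2 s2 -> run O (Seq c1 c2) s (t1 + t2) s2.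
Proof.
case=> a lea H1 [b leb H2]; exists (a + b); first exact: leq_add.
exact: ExecSeq H1 H2.
Qed.

Lemma run_while_end O x c s : s x = [::] -> run O (While x c) s 1 s.
Proof. by move=> h; exists 1 => //; constructor. Qed.

Lemma run_while_step {O x c s t1 s1 t2 s2} : s x <> [::] ->
  run O c s t1 s1 -> run O (While x c) s1 t2 s2 ->
  run O (While x c) s (t1 + t2).+1 s2.
Proof.
move=> h [a lea H1] [b leb H2]; exists (a + b).+1; first by rewrite ltnS leq_add.
exact: ExecWhileStep H1 H2.
Qed.

(** Symbolic evaluation along paths without loops and queries, so that [run_ev] obtains such runs by
    mere computation. *)
Fixpoint ev (c : cmd) (l : seq (seq sym)) : option (nat * seq (seq sym)) :=
  match c with
  | Skip => Some (1, l)
  | Push x a => Some (1, set_nth [::] l x (a :: nth [::] l x))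
  | Pop x => Some (1, set_nth [::] l x (behead (nth [::] l x)))
  | Seq c1 c2 =>
      if ev c1 l is Some (t1, l1) then
        if ev c2 l1 is Some (t2, l2) then Some (t1 + t2, l2) else None
      else None
  | Case x ce c0 c1 cs =>
      let r := match nth [::] l x with
               | [::] => ev ce l
               | Bit false :: _ => ev c0 l
               | Bit true :: _ => ev c1 l
               | Sep :: _ => ev cs l
               end in
      if r is Some (t, l') then Some (t.+1, l') else None
  | _ => None
  end.

Lemma run_ev {O c l t l'} : ev c l = Some (t, l') -> run O c (st l) t (st l').
Proof.
suff H : ev c l = Some (t, l') -> exec O c (st l) t (st l') by move/H; exists t.
elim: c l t l' => //=.
- by move=> l t l' [<- <-]; constructor.
- by move=> x a l t l' [<- <-]; rewrite -upd_st; constructor.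
- by move=> x l t l' [<- <-]; rewrite -upd_st; constructor.
- move=> c1 IH1 c2 IH2 l t l'.
  case E1: (ev c1 l) => [[t1 l1]|] //; case E2: (ev c2 l1) => [[t2 l2]|] //.
  by move=> [<- <-]; apply: ExecSeq; [apply: IH1 E1 | apply: IH2 E2].
- move=> x ce IHe c0 IH0 c1 IH1 cs IHs l t l' E.
  suff [t1 -> H] : exists2 t1, t = t1.+1 &
      exec O (branch (st l x) ce c0 c1 cs) (st l) t1 (st l') by apply: ExecCase.
  move: E; rewrite /branch /st; case: (nth [::] l x) => [|[[]|] w];
    case E: (ev _ _) => [[t1 l1]|] //= [<- <-]; exists t1 => //; eauto.
Qed.

(** Command and store determine the applicable rule. Hence a utility program fixes its utility
    function. *)
Lemma exec_det {O c s t1 s1 t2 s2} :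
  exec O c s t1 s1 -> exec O c s t2 s2 -> s1 = s2.
Proof.
move=> H; elim: H t2 s2 => {c s t1 s1}.
- by move=> s t2 s2 H; inversion H.
- by move=> s x a t2 s2 H; inversion H.
- by move=> s x t2 s2 H; inversion H.
- by move=> s x t2 s2 H; inversion H.
- move=> c1 c2 s t1 s1 t2 s2 _ IH1 _ IH2 t3 s3 H; inversion H; subst.
  match goal with E1 : exec _ c1 s _ ?u, E2 : exec _ c2 ?u _ _ |- _ =>
    by rewrite -(IH1 _ _ E1) in E2; apply: IH2 E2 end.
- by move=> x ce c0 c1 cs s t s' _ IH t2 s2 H; inversion H; subst; apply: IH; eassumption.
- by move=> x c s h t2 s2 H; inversion H.
- move=> x c s t1 s1 t2 s2 h _ IH1 _ IH2 t3 s3 H; inversion H; subst => //.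
  match goal with E1 : exec _ c s _ ?u, E2 : exec _ _ ?u _ _ |- _ =>
    by rewrite -(IH1 _ _ E1) in E2; apply: IH2 E2 end.
Qed.

(** * Basic programs: pushing, clearing and moving words *)

Definition tick := Bit true.

Definition pushw (x : nat) (w : seq sym) : cmd :=
  foldr (fun a c => Seq c (Push x a)) Skip w.

Lemma run_pushw O x w s : run O (pushw x w) s (size w).+1 (upd s x (w ++ s x)).
Proof.
elim: w => [|a w IH] /=.
  exists 1 => //.
  have -> : upd s x (s x) = s by apply: funext => y; rewrite /upd; case: eqP => // ->.
  exact: ExecSkip.
rewrite -addn1; apply: (run_seq IH); exists 1 => //.
have -> : upd s x (a :: w ++ s x) =
          upd (upd s x (w ++ s x)) x (a :: upd s x (w ++ s x) x).
  by apply: funext => y; rewrite /upd eqxx; case: eqP.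
exact: ExecPush.
Qed.

Definition clear (x : nat) : cmd := While x (Pop x).

Lemma exec_clear O x s : exec O (clear x) s (2 * size (s x)).+1 (upd s x [::]).
Proof.
move E : (s x) => w; elim: w s E => [|a w IH] s E.
  have -> : upd s x [::] = s by apply: funext => y; rewrite /upd; case: eqP => // ->.
  exact: ExecWhileEnd.
have -> : (2 * size (a :: w)).+1 = (1 + (2 * size w).+1).+1 by rewrite /=; lia.
have -> : upd s x [::] = upd (upd s x (behead (s x))) x [::].
  by apply: funext => y; rewrite /upd; case: eqP.
apply: ExecWhileStep; first by rewrite E.
- exact: ExecPop.
- by apply: IH; rewrite /upd eqxx E.
Qed.

Lemma run_clear O x s : run O (clear x) s (2 * size (s x)).+1 (upd s x [::]).
Proof. by eexists; [exact: leqnn | exact: exec_clear]. Qed.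

(** Counting, copying and translating are all instances: [y] keeps the word, reversed, while [z]
    receives the images of its symbols. *)
Definition xfer (x y z : nat) (f : sym -> seq sym) : cmd :=
  let body a := Seq (Pop x) (Seq (Push y a) (pushw z (f a))) in
  While x (Case x Skip (body (Bit false)) (body (Bit true)) (body Sep)).

(** Each symbol costs the loop test, the case distinction, a pop, a push and at most K + 1 steps of
    [pushw], hence K + 5. *)
Lemma run_xfer O x y z f K s : x != y -> y != z -> x != z ->
  (forall a, size (f a) <= K) ->
  run O (xfer x y z f) s ((K + 5) * size (s x)).+1
    (upd (upd (upd s x [::]) y (catrev (s x) (s y)))
      z (foldl (fun r a => f a ++ r) (s z) (s x))).
Proof.
move=> /eqP xy /eqP yz /eqP xz fK; move E : (s x) => w; elim: w s E => [|a w IH] s E.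
  rewrite muln0; apply: (run_eq (run_while_end _ _ _ _ E)).
  by move=> u; rewrite /upd; do! case: eqP => [-> //|_].
set s1 := upd (upd (upd s x w) y (a :: s y)) z (f a ++ s z).
have Es1 : s1 x = w by rewrite /s1 /upd; do! case: eqP => // _.
have {}IH := IH s1 Es1.
have Hb : run O (Seq (Pop x) (Seq (Push y a) (pushw z (f a)))) s (K + 3) s1.
  have -> : K + 3 = 1 + (1 + K.+1) by lia.
  apply: run_seq; first by exists 1 => //; apply: ExecPop.
  apply: run_seq; first by exists 1 => //; apply: ExecPush.
  apply: (run_eq (run_le (run_pushw _ _ _ _) _)); first by rewrite ltnS.
  by move=> u; rewrite /s1 /upd E /=; do! case: eqP => ? //; congruence.
have Hc : run O (let body a := Seq (Pop x) (Seq (Push y a) (pushw z (f a))) in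
    Case x Skip (body (Bit false)) (body (Bit true)) (body Sep)) s (K + 4) s1.
  case: Hb => t lt Hb; exists t.+1; first by lia.
  apply: ExecCase; rewrite E /=; clear IH; clearbody s1.
  by case: a {E} Hb => [[]|].
apply: (run_le (run_eq (run_while_step _ Hc IH) _)); first by rewrite E.
  by move=> u; rewrite /s1 /upd; do! case: eqP => ? //; congruence.
by rewrite /= mulnS; lia.
Qed.

(** The stack [(x + y).+1] is a dummy distinct from [x] and [y]; it is left unchanged. *)
Definition mv (x y : nat) : cmd := xfer x y (x + y).+1 (fun=> [::]).

Lemma run_mv O x y s : x != y ->
  run O (mv x y) s (5 * size (s x)).+1
    (upd (upd s x [::]) y (catrev (s x) (s y))).
Proof.
move=> xy; apply: (run_eq (run_xfer _ _ _ _ _ 0 _ _ _ _ _)) => //; try by apply/eqP; lia.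
move=> u; rewrite {1}/upd; case: eqP => // ->.
rewrite /upd !ifN; try by apply/eqP; lia.
by elim: (s x).
Qed.

(* Without an oracle, a query only empties its stack. *)
Fixpoint queryless (c : cmd) : cmd :=
  match c with
  | Query x => clear x
  | Seq c1 c2 => Seq (queryless c1) (queryless c2)
  | Case x ce c0 c1 cs =>
      Case x (queryless ce) (queryless c0) (queryless c1) (queryless cs)
  | While x c => While x (queryless c)
  | _ => c
  end.

(** This lets the verifier run next to an arbitrary oracle. The factor 2 comes from [clear], which
    spends two steps per symbol where the query is charged one. *)
Lemma run_queryless O c s t s' :
  exec no_oracle c s t s' -> run O (queryless c) s (2 * t) s'.
Proof.
elim=> {c s t s'} /=.
- by move=> s; exists 1 => //; constructor.
- by move=> s x a; exists 1 => //; constructor.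
- by move=> s x; exists 1 => //; constructor.
- by move=> s x; apply: (run_le (run_clear _ _ _)); lia.
- by move=> c1 c2 s t1 s1 t2 s2 _ H1 _ H2; rewrite mulnDr; apply: run_seq H1 H2.
- move=> x ce c0 c1 cs s t s' _ [t' lt H]; exists t'.+1; first by lia.
  by apply: ExecCase; move: H; case: (s x) => [|[[]|] w].
- by move=> x c s h; exists 1 => //; constructor.
- move=> x c s t1 s1 t2 s2 h _ H1 _ H2.
  by apply: (run_le (run_while_step h H1 H2)); lia.
Qed.

(** * Injectivity of the encodings *)

Lemma binE k : bin k = Bit (odd k) :: (if k < 2 then [::] else bin k./2).
Proof.
rewrite /bin /mkseq /= expn0 divn1; congr (_ :: _).
case: ltnP => [|k2]; first by case: k => [|[|]].
rewrite trunc_log2S // (iotaDl 1 0) -map_comp; apply: eq_map => i /=.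
by rewrite add1n expnS divnMA divn2.
Qed.

(** Binary digits are never [Sep], so the first separator shows where the number ends; the induction
    strips the lowest digit. *)
Lemma bin_cat_inj x y r r' :
  bin x ++ Sep :: r = bin y ++ Sep :: r' -> x = y /\ r = r'.
Proof.
elim/ltn_ind: x y => x IH y; rewrite (binE x) (binE y) !cat_cons => -[E].
case: ltnP => hx; case: ltnP => hy; rewrite ?cat0s; try by rewrite (binE _./2).
  by case=> ->; split => //; case: x y E hx hy {IH} => [|[|//]] [|[|//]].
have lt : x./2 < x by rewrite -divn2 ltn_Pdiv //; lia.
move=> /(IH _ lt) [E' ->].
by split=> //; rewrite -(odd_double_half x) -(odd_double_half y) E E'.
Qed.

Lemma bin_inj : injective bin.
Proof. by move=> x y E; case: (@bin_cat_inj x y [::] [::]) => //; rewrite E. Qed.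

Lemma size_bin k : size (bin k) <= k.+1.
Proof.
elim/ltn_ind: k => k IH; rewrite binE; case: ltnP => // k2.
have lt : k./2 < k by rewrite -divn2 ltn_Pdiv //; lia.
by apply: leq_ltn_trans (IH _ lt) _.
Qed.

Local Opaque bin.

Lemma cons_inj {T} {a b : T} {s t} : a :: s = b :: t -> a = b /\ s = t.
Proof. by case. Qed.

Lemma enc_rat_inj : injective enc_rat.
Proof.
move=> r s /cons_inj [[E1] /bin_cat_inj [E2 /bin_inj E3]].
rewrite -(divq_num_den r) -(divq_num_den s).
have -> : denq r = denq s by rewrite -(absz_denq r) -(absz_denq s) E3.
by rewrite (intEsign (numq r)) (intEsign (numq s)) !numq_lt0 E1 E2.
Qed.

(** Polish notation is prefix-free. The arbitrary suffixes let the induction pass through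
    consecutive subprograms. *)
Lemma enc_cmd_cat_inj c c' r r' :
  enc_cmd c ++ r = enc_cmd c' ++ r' -> c = c' /\ r = r'.
Proof.
elim: c c' r r' => [|x a|x|x|c1 IH1 c2 IH2|x ce IHe c0 IH0 c1 IH1 cs IHs|x c IH]
    [|x' a'|x'|x'|c1' c2'|x' ce' c0' c1' cs'|x' c'] r r' //=;
  move=> /cons_inj [_ /cons_inj [_ /cons_inj [_]]]; rewrite -?catA /= -?catA //=.
- by move=> /bin_cat_inj [-> /cons_inj [-> ->]].
- by move=> /bin_cat_inj [-> ->].
- by move=> /bin_cat_inj [-> ->].
- by move=> /IH1 [-> /IH2 [-> ->]].
- by move=> /bin_cat_inj [-> /IHe [-> /IH0 [-> /IH1 [-> /IHs [-> ->]]]]].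
- by move=> /bin_cat_inj [-> /IH [-> ->]].
Qed.

Lemma unary_cat_inj m m' r r' :
  unary m ++ Sep :: r = unary m' ++ Sep :: r' -> m = m' /\ r = r'.
Proof.
elim: m m' => [|m IH] [|m'] //=; first by case.
by case=> /IH [-> ->].
Qed.

Lemma enc_instance_inj m n u m' n' u' :
  enc_instance m n u = enc_instance m' n' u' -> [/\ m = m', n = n' & u = u'].
Proof.
move=> /unary_cat_inj [-> /unary_cat_inj [-> E]].
by case: (@enc_cmd_cat_inj u u' [::] [::]); rewrite ?cats0.
Qed.

(** * Words coded by matchings *)

Fixpoint skipw (w : seq sym) : seq sym :=
  match w with
  | [::] => [::]
  | Sep :: w' => w'
  | Bit _ :: w' => skipw w'
  end.

(* An edge (i, j) carries the second lowest bit of j if j is odd, and nothing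
   otherwise. *)
Definition readw (w : seq sym) (acc : seq bool) : seq sym * seq bool :=
  if w is Bit true :: w' then (w', (if w' is Bit true :: _ then true else false) :: acc)
  else (w, acc).

(** Treats one edge: skip the left endpoint, read the low digits of the right one, skip what remains
    of it. *)
Definition decode_step (wa : seq sym * seq bool) : seq sym * seq bool :=
  let wa' := readw (skipw wa.1) wa.2 in (skipw wa'.1, wa'.2).

Definition decode (k : nat) (w : seq sym) : seq bool :=
  (iter k decode_step (w, [::])).2.

Lemma size_skipw w : size (skipw w) <= size w.
Proof. by elim: w => [|[b|] w IH] //=; apply: leq_trans IH _. Qed.

Lemma size_readw w acc : size (readw w acc).1 <= size w.
Proof. by case: w => [|[[]|] w] /=. Qed.

Lemma size_decode_step wa : size (decode_step wa).1 <= size wa.1.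
Proof.
exact: leq_trans (size_skipw _) (leq_trans (size_readw _ _) (size_skipw _)).
Qed.

(** A step adds at most one bit, on any input word. So whatever matching the oracle returns, the
    word read off it is short enough to be a witness. *)
Lemma size_decode k w : size (decode k w) <= k.
Proof.
rewrite /decode; elim: k => //= k IH; move: (iter _ _ _) IH => [v acc] /=.
rewrite /decode_step /readw /=; case: (skipw v) => [|[[]|] u] //= h.
all: exact: leq_trans h _.
Qed.

Lemma skipw_bin k r : skipw (bin k ++ Sep :: r) = r.
Proof.
elim/ltn_ind: k => k IH; rewrite binE /=; case: ltnP => // k2.
by apply: IH; rewrite -divn2 ltn_Pdiv //; lia.
Qed.

Lemma decode_step_edge i j r acc :
  decode_step (bin i ++ Sep :: bin j ++ Sep :: r, acc) =
  (r, if odd j then odd j./2 :: acc else acc).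
Proof.
rewrite /decode_step /= skipw_bin; case oj : (odd j); last first.
  by move: (skipw_bin j r); rewrite binE oj /= => ->.
(* For j = 1 the symbol after the lowest digit is the separator; it is read as 0, which is the
   parity of [1./2]. *)
rewrite binE oj /=; case: ltnP => j2 /=.
  by case: j oj j2 => [|[|]].
by rewrite skipw_bin binE /=; case: odd.
Qed.

Definition enc_edge (i j : nat) : seq sym := bin i ++ Sep :: bin j ++ [:: Sep].

Lemma iter_decode_step (es : seq (nat * nat)) k acc : k <= size es ->
  (iter k decode_step (flatten [seq enc_edge e.1 e.2 | e <- es], acc)).2 =
  rev [seq odd e.2./2 | e <- take k es & odd e.2] ++ acc.
Proof.
elim: es k acc => [|[i j] es IH] [|k] acc // hk.
rewrite iterSr [flatten _]/= /enc_edge -catA cat_cons -catA cat_cons.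
rewrite decode_step_edge IH //=.
by case: odd => //=; rewrite rev_cons cat_rcons.
Qed.

(* The vertex that the matching coding the word w joins to the vertex i. *)
Definition code (w : seq bool) (i : nat) : nat :=
  4 * i + 2 * nth false (rev w) i + (i < size w).

Lemma odd_code w i : odd (code w i) = (i < size w).
Proof. by rewrite /code; case: (nth _ _ _); lia. Qed.

Lemma odd_half_code w i : odd (code w i)./2 = nth false (rev w) i.
Proof.
have -> : (code w i)./2 = 2 * i + nth false (rev w) i.
  by rewrite /code; lia.
by case: (nth _ _ _); lia.
Qed.

Lemma code_lt w i m : i < m -> code w i < 4 * m.
Proof. by rewrite /code; lia. Qed.

Lemma decode_code w k m : size w <= k <= m ->
  decode k (flatten [seq enc_edge i (code w i) | i <- iota 0 m]) = w.
Proof.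
case/andP=> wk km; rewrite /decode.
have -> : [seq enc_edge i (code w i) | i <- iota 0 m] =
    [seq enc_edge e.1 e.2 | e <- [seq (i, code w i) | i <- iota 0 m]].
  by rewrite -map_comp.
rewrite iter_decode_step ?size_map ?size_iota // cats0 -map_take take_iota.
rewrite (minn_idPl km) filter_map -map_comp /=.
rewrite (eq_filter (odd_code w)) (eq_map (odd_half_code w)).
(* Split the first k vertices at [size w]: all those before carry a bit, none of those after
   does. *)
rewrite -(subnKC wk) iotaD filter_cat.
have /all_filterP -> : all (fun i => i < size w) (iota 0 (size w)).
  by apply/allP => i; rewrite mem_iota.
rewrite (eq_in_filter (a2 := pred0)) ?filter_pred0 ?cats0; last first.
  by move=> i; rewrite mem_iota /= ltnNge; case: leqP => //; case/andP.
by rewrite -(size_rev w) map_nth_iota0 // take_size revK.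
Qed.

(** * Perfect matchings given by injections *)

(** Pairs are enumerated lexicographically, so the encoding lists the edges by left endpoint, the
    order that the decoder relies on. *)
Lemma enum_graph m n (f : 'I_m -> 'I_n) :
  enum [set e : 'I_m * 'I_n | e.2 == f e.1] = [seq (i, f i) | i <- enum 'I_m].
Proof.
rewrite {1}/enum_mem -enumT.
have -> : enum {: 'I_m * 'I_n} = [seq (i, j) | i <- enum 'I_m, j <- enum 'I_n].
  by rewrite enumT unlock.
elim: (enum 'I_m) => //= i s IH; rewrite filter_cat IH filter_map.
rewrite (eq_filter (a2 := pred1 (f i))); last by move=> j; rewrite /= inE.
by rewrite filter_pred1_uniq ?enum_uniq ?mem_enum.
Qed.

(** Maximality: a further edge (i, j) would share i with (i, f i). *)
Lemma graph_perfect m n (f : 'I_m -> 'I_n) : injective f ->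
  perfect [set e : 'I_m * 'I_n | e.2 == f e.1].
Proof.
move=> fI; apply/andP; split.
  apply/forall_inP => -[i j]; rewrite inE => /eqP /= ->.
  apply/forall_inP => -[i' j']; rewrite inE => /eqP /= ->.
  apply/implyP; apply: contraR; rewrite negb_and !negbK.
  by case/orP=> /eqP; [move=> -> | move/fI ->].
apply/forallP => -[i j]; apply/implyP; rewrite inE /= => nij.
apply/negP => /forall_inP /(_ (i, j)); rewrite !inE eqxx => /(_ isT).
move=> /forall_inP /(_ (i, f i)); rewrite !inE eqxx orbT => /(_ isT).
by rewrite /= eqxx /= implybF negbK => /eqP [E]; rewrite E eqxx in nij.
Qed.

Definition code_fun w m (i : 'I_m) : 'I_(4 * m) :=
  Ordinal (code_lt w i m (ltn_ord i)).

Lemma code_fun_inj w m : injective (code_fun w m).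
Proof. by move=> i j [E]; apply: val_inj; move: E; rewrite /code /=; lia. Qed.

Definition code_matching w m : perfect_matching m (4 * m) :=
  exist (@perfect m (4 * m)) _ (graph_perfect _ _ _ (code_fun_inj w m)).

Lemma decode_code_matching w k m : size w <= k <= m ->
  decode k (enc_matching (code_matching w m)) = w.
Proof.
move=> h; rewrite /enc_matching /= enum_graph -[RHS](decode_code _ _ _ h).
by rewrite -val_enum_ord -!map_comp.
Qed.

Lemma size_enc_matching m n (M : perfect_matching m n) :
  size (enc_matching M) <= m * n * (m + n + 2).
Proof.
apply: (@leq_trans (#|sval M| * (m + n + 2))); last first.
  rewrite leq_mul2r; apply/orP; right.
  by apply: leq_trans (max_card _) _; rewrite card_prod !card_ord.
rewrite /enc_matching cardE; elim: (enum _) => //= -[i j] s IH.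
rewrite size_cat mulSn leq_add // size_cat /= size_cat /=.
have := leq_trans (size_bin i) (ltn_ord i).
by have := leq_trans (size_bin j) (ltn_ord j); lia.
Qed.

(** * The utility program *)

(** Stack 4 holds a flag that keeps the loop alive until a separator or the end of the word is
    met. *)
Definition skipc : cmd :=
  Seq (Push 4 Sep)
    (While 4 (Case 0 (Pop 4) (Pop 0) (Pop 0) (Seq (Pop 0) (Pop 4)))).

Lemma run_skipc O w a b c l :
  run O skipc (st [:: w, a, b, c, [::] & l]) (4 * size w + 6)
    (st [:: skipw w, a, b, c, [::] & l]).
Proof.
have -> : 4 * size w + 6 = 1 + (4 * size w + 5) by lia.
apply: run_seq; first by apply: run_ev.
rewrite /=; elim: w => [|d w IH].
  apply: run_le (run_while_step _ _ (run_while_end _ _ _ _ _)) _ => //.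
    by apply: run_ev.
  by [].
case: d => [d|]; last first.
  apply: run_le (run_while_step _ _ (run_while_end _ _ _ _ _)) _ => //.
    by apply: run_ev.
  by rewrite /=; lia.
apply: run_le (run_while_step _ _ IH) _ => //.
  by case: d; apply: run_ev.
by rewrite /=; lia.
Qed.

Definition readc : cmd :=
  Case 0 Skip Skip
    (Seq (Pop 0) (Case 0 (Push 1 (Bit false)) (Push 1 (Bit false))
                         (Push 1 (Bit true)) (Push 1 (Bit false)))) Skip.

Lemma run_readc O w acc l :
  run O readc (st [:: w, bits acc & l]) 4
    (st [:: (readw w acc).1, bits (readw w acc).2 & l]).
Proof.
case: w => [|[[|]|] [|[[|]|] w]]; by apply: (run_le (run_ev _)).
Qed.

Definition decodec : cmd :=
  While 3 (Seq (Pop 3) (Seq skipc (Seq readc skipc))).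

(** A round costs two [skipc] of at most 4S + 6 steps, [readc] with 4, a pop and the loop test: 8S +
    18. The bound S persists because decoding never lengthens the word. *)
Lemma run_decodec O k wa b l S : size wa.1 <= S ->
  run O decodec (st [:: wa.1, bits wa.2, b, nseq k tick, [::] & l])
    (k * (8 * S + 18)).+1
    (st [:: (iter k decode_step wa).1, bits (iter k decode_step wa).2, b,
        [::], [::] & l]).
Proof.
elim: k wa => [|k IH] wa h; first exact: run_while_end.
rewrite iterSr.
have {}IH := IH _ (leq_trans (size_decode_step wa) h).
have h1 := leq_trans (size_skipw _) h.
have h2 := leq_trans (size_readw _ wa.2) h1.
apply: (run_le (run_while_step _ _ IH)) => //.
- apply: run_seq; first by apply: run_ev.
  apply: run_seq; first exact: run_skipc.
  apply: run_seq; first exact: run_readc.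
  exact: run_skipc.
- by rewrite mulSn; lia.
Qed.

(* Started with an encoded matching on the stack 0, the reverse of x on 2 and k
   ticks on 3, runs the verifier on x and the word that the matching codes. *)
Definition checkc (v : cmd) : cmd :=
  Seq decodec (Seq (clear 0) (Seq (mv 2 0) (queryless v))).

Definition check_time (p : {poly nat}) (n k S : nat) : nat :=
  (k * (8 * S + 18)).+1 + ((2 * S).+1 + ((5 * n).+1 + 2 * p.[n + k]%R)).

Lemma horner_nat_le (p : {poly nat}) a b : a <= b -> p.[a]%R <= p.[b]%R.
Proof.
move=> ab; elim/poly_ind: p => [|p c IH]; first by rewrite !horner0.
by rewrite !hornerMXaddC leq_add // leq_mul.
Qed.

Lemma run_checkc O v V p x k w :
  (forall x w, runs no_oracle v [:: bits x; bits w]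
                 p.[size x + size w]%R [:: Bit (V x w)]) ->
  exists2 s', s' 0 = [:: Bit (V x (decode k w))] &
    run O (checkc v) (st [:: w; [::]; rev (bits x); nseq k tick; [::]])
      (check_time p (size x) k (size w)) s'.
Proof.
move=> Hv; have [t' [s' [H lt E]]] := Hv x (decode k w).
exists s' => //; apply: run_seq; first exact: (run_decodec _ _ (w, [::])).
have le_w : size (iter k decode_step (w, [::])).1 <= size w.
  elim: k {H lt E Hv} => //= k IH; exact: leq_trans (size_decode_step _) IH.
apply: run_seq.
  by apply: (run_le (run_clear _ _ _)); rewrite ltnS leq_mul2l.
apply: run_seq.
  by apply: (run_le (run_mv _ _ _ _ _)) => //; rewrite upd_st /= size_rev size_map.
rewrite !upd_st /= catrevE revK cats0.
set l := (X in st X).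
(* All other stacks are empty by now, so the verifier starts from exactly the store of its
   specification. *)
have -> : st l = nth [::] [:: bits x; bits (decode k w)].
  by apply: funext => -[|[|[|[|[|[|u]]]]]].
apply: (run_le (run_queryless _ _ _ _ _ H)).
rewrite leq_mul2l; apply/orP; right; apply: leq_trans lt _.
by apply: horner_nat_le; rewrite leq_add2l size_decode.
Qed.

(** The word written is the fraction b/1: sign, [bin b], separator, [bin 1]. *)
Definition postc : cmd :=
  let out b := Seq (Pop 0) (pushw 0 [:: Bit false; Bit b; Sep; tick]) in
  Case 0 Skip (out false) (out true) Skip.

Lemma enc_rat_bool (b : bool) : enc_rat b%:R%R = [:: Bit false; Bit b; Sep; tick].
Proof.
rewrite /enc_rat ltNge ler0n pmulrn numq_int denq_int !absz_nat.
by rewrite (binE b) (binE 1); case: b.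
Qed.

Lemma run_postc O s b : s 0 = [:: Bit b] ->
  exists2 s', s' 0 = enc_rat b%:R%R & run O postc s 7 s'.
Proof.
move=> E; set s1 := upd s 0 (behead (s 0)).
exists (upd s1 0 (enc_rat b%:R%R ++ s1 0)); first by rewrite /s1 /upd /= E cats0.
have [t lt H] : run O (Seq (Pop 0) (pushw 0 (enc_rat b%:R%R))) s 6
    (upd s1 0 (enc_rat b%:R%R ++ s1 0)).
  have -> : 6 = 1 + (size (enc_rat b%:R%R)).+1 by rewrite enc_rat_bool.
  apply: run_seq; last exact: run_pushw.
  by exists 1 => //; apply: ExecPop.
exists t.+1 => //; apply: ExecCase; rewrite E; move: H; rewrite enc_rat_bool.
by case: (b).
Qed.

(** Unlike [pushw], this nests to the right around a continuation: its code is a right fold over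
    [w], which the reduction can write out symbol by symbol with [xfer]. *)
Definition pushes (x : nat) (w : seq sym) (c : cmd) : cmd :=
  foldr (fun a => Seq (Push x a)) c w.

Lemma run_pushes O x w c s t s' : run O c (upd s x (catrev w (s x))) t s' ->
  run O (pushes x w c) s (size w + t) s'.
Proof.
elim: w s => [|a w IH] s H.
  have -> : s = upd s x (s x) by apply: funext => y; rewrite /upd; case: eqP => // ->.
  exact: H.
rewrite /= -add1n -addnA; apply: (@run_seq _ _ _ _ _ (upd s x (a :: s x))).
  by exists 1 => //; apply: ExecPush.
apply: IH; move: H; rewrite /= [upd s x (a :: _) x]/upd eqxx.
have -> // : upd (upd s x (a :: s x)) x (catrev w (a :: s x)) =
          upd s x (catrev w (a :: s x)).
by apply: funext => y; rewrite /upd; case: eqP.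
Qed.

Definition evalc (v : cmd) : cmd := Seq (checkc v) postc.

(** The input x and the number k are hard-wired, since a utility program receives only the
    matching. *)
Definition utilc (v : cmd) (x : seq bool) (k : nat) : cmd :=
  pushes 2 (bits x) (pushes 3 (nseq k tick) (evalc v)).

Definition util_time (p : {poly nat}) (n k S : nat) : nat :=
  n + (k + (check_time p n k S + 7)).

Lemma runs_utilc O v V p x k w :
  (forall x w, runs no_oracle v [:: bits x; bits w]
                 p.[size x + size w]%R [:: Bit (V x w)]) ->
  runs O (utilc v x k) [:: w] (util_time p (size x) k (size w))
    (enc_rat (V x (decode k w))%:R%R).
Proof.
move=> Hv; have [s1 E1 H1] := run_checkc O _ _ _ x k w Hv.
have [s2 E2 H2] := run_postc O _ _ E1.
suff [t lt H] : run O (utilc v x k) (st [:: w]) (util_time p (size x) k (size w)) s2.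
  by exists t, s2.
have -> : util_time p (size x) k (size w) = size (bits x) +
    (size (nseq k tick) + (check_time p (size x) k (size w) + 7)).
  by rewrite size_map size_nseq.
do 2!apply: run_pushes.
rewrite !upd_st /= !catrevE !cats0 rev_nseq; apply: run_seq H2.
set l := (X in st X); set l1 := [:: _; _; _; _; _] in H1.
by have -> : st l = st l1 by apply: funext => -[|[|[|[|[|[|u]]]]]].
Qed.

(** * Construction of the instance *)

Lemma foldl_push_nseq (a : sym) i n :
  foldl (fun r _ => [:: a] ++ r) (nseq i a) (nseq n a) = nseq (n + i) a.
Proof. by elim: n i => [|n IH] i //=; rewrite (IH i.+1) addnS. Qed.

(** Multiplication in unary: stack 6 counts the rounds, each of which copies stack 5 onto stack 3 by
    way of stack 7. *)
Definition mulc : cmd :=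
  Seq (mv 3 6)
    (While 6 (Seq (Pop 6) (Seq (xfer 5 7 3 (fun=> [:: tick])) (mv 7 5)))).

Lemma run_mulc O a b c d i n :
  run O mulc
    (st [:: a; b; c; nseq i tick; d; nseq n tick; [::]; [::]])
    (i * (11 * n + 9) + 2)
    (st [:: a; b; c; nseq (i * n) tick; d; nseq n tick; [::]; [::]]).
Proof.
have -> : i * (11 * n + 9) + 2 = (5 * i).+1 + (i * (11 * n + 4)).+1 by lia.
apply: run_seq.
  by apply: (run_le (run_mv _ _ _ _ _)); rewrite //= size_nseq.
rewrite !upd_st /= catrevE rev_nseq cats0.
(* The induction needs an arbitrary number j of ticks already accumulated on stack 3. *)
suff loop j : run O
    (While 6 (Seq (Pop 6) (Seq (xfer 5 7 3 (fun=> [:: tick])) (mv 7 5))))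
    (st [:: a; b; c; nseq j tick; d; nseq n tick; nseq i tick; [::]])
    (i * (11 * n + 4)).+1
    (st [:: a; b; c; nseq (i * n + j) tick; d; nseq n tick; [::]; [::]]).
  by move: (loop 0); rewrite addn0.
elim: i j => [|i IH] j; first exact: run_while_end.
have -> : i.+1 * n + j = i * n + (n + j) by rewrite mulSn; lia.
apply: (run_le (run_while_step _ _ (IH (n + j)))) => //.
  apply: run_seq; first by apply: run_ev.
  apply: run_seq.
    by apply: (run_xfer _ _ _ _ _ 1).
  rewrite !upd_st /= catrevE rev_nseq cats0 foldl_push_nseq.
  apply: (run_eq (run_mv _ _ _ _ _)) => //.
  by rewrite !upd_st /= catrevE rev_nseq cats0.
by rewrite /= !size_nseq mulSn; lia.
Qed.

(** Horner's scheme in unary, with the coefficients built into the program and the argument on stack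
    5. *)
Fixpoint hornerc (s : seq nat) : cmd :=
  if s is a :: s' then Seq (hornerc s') (Seq mulc (pushw 3 (nseq a tick)))
  else Skip.

Fixpoint horner_time (s : seq nat) (n : nat) : nat :=
  if s is a :: s' then
    horner_time s' n + (horner_rec s' n * (11 * n + 9) + 2 + a.+1)
  else 1.

Lemma run_hornerc O (s : seq nat) a b c d n :
  run O (hornerc s)
    (st [:: a; b; c; [::]; d; nseq n tick; [::]; [::]])
    (horner_time s n)
    (st [:: a; b; c; nseq (horner_rec s n) tick; d; nseq n tick; [::]; [::]]).
Proof.
elim: s => [|e s IH]; first by apply: run_ev.
apply: run_seq IH _; apply: run_seq (run_mulc _ _ _ _ _ _ _) _.
apply: (run_le (run_eq (run_pushw _ _ _ _) _)); last by rewrite size_nseq.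
by rewrite upd_st /= -nseqD addnC.
Qed.

Lemma st_pad k l : st (l ++ nseq k [::]) = st l.
Proof.
apply: funext => i; rewrite /st nth_cat nth_nseq if_same.
by case: ltnP => // h; rewrite nth_default.
Qed.

(** The contribution of one layer of [pushes] to the code: the tag of [Seq], then the code of
    [Push x a]. *)
Definition enc_push (x : nat) (a : sym) : seq sym :=
  Defs.tag true false false ++ Defs.tag false false true ++ bin x ++ [:: Sep; a].

Lemma enc_pushes x w c :
  enc_cmd (pushes x w c) = foldr (fun a r => enc_push x a ++ r) (enc_cmd c) w.
Proof. by elim: w => //= a w ->; rewrite /enc_push -!catA. Qed.

Lemma size_enc_push x a : size (enc_push x a) <= size (bin x) + 8.
Proof. by rewrite /enc_push !size_cat /=; lia. Qed.

Local Opaque enc_push.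

(** A stack grows at its front, so the instance is written on stack 0 from its end to its beginning.
    The reversed x and k are restored on stacks 2 and 3, ready for [checkc]. *)
Definition buildc (v : cmd) (q m : {poly nat}) : cmd :=
  Seq (xfer 0 2 5 (fun=> [:: tick]))
  (Seq (hornerc m) (Seq (mv 3 1) (Seq (hornerc q) (Seq (clear 5)
  (Seq (pushw 0 (enc_cmd (evalc v)))
  (Seq (xfer 3 7 0 (enc_push 3)) (Seq (mv 7 3)
  (Seq (xfer 2 7 0 (enc_push 2)) (Seq (mv 7 2)
  (Seq (Push 0 Sep) (Seq (xfer 1 7 0 (fun=> nseq 4 tick))
  (Seq (Push 0 Sep) (mv 7 0))))))))))))).

Definition build_time (v : cmd) (q m : {poly nat}) (n : nat) : nat :=
  (6 * n).+1 +
  (horner_time m n + ((5 * m.[n]%R).+1 + (horner_time q n + ((2 * n).+1 +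
  ((size (enc_cmd (evalc v))).+1 +
  (((size (bin 3) + 13) * q.[n]%R).+1 + ((5 * q.[n]%R).+1 +
  (((size (bin 2) + 13) * n).+1 + ((5 * n).+1 +
  (1 + ((9 * m.[n]%R).+1 + (1 + (5 * m.[n]%R).+1)))))))))))).

Lemma foldl_nseq4 r m :
  foldl (fun r _ => nseq 4 tick ++ r) r (nseq m tick) = nseq (4 * m) tick ++ r.
Proof.
elim: m r => // m IH r; rewrite [LHS]/= -[_ :: _]/(nseq 4 tick ++ r) IH catA -nseqD.
by congr (nseq _ _ ++ _); lia.
Qed.

Lemma run_buildc O v q m x :
  let n := size x in
  run O (buildc v q m) (st [:: bits x]) (build_time v q m n)
    (st [:: enc_instance m.[n]%R (4 * m.[n]%R) (utilc v x q.[n]%R); [::];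
        rev (bits x); nseq q.[n]%R tick; [::]]).
Proof.
move=> n.
have Ex : size (bits x) = n by rewrite size_map.
rewrite /buildc /build_time /enc_instance /utilc !enc_pushes.
move: (enc_cmd (evalc v)) => W.
apply: run_seq; first by rewrite -Ex; apply: (run_xfer _ _ _ _ _ 1).
rewrite !upd_st /= catrevE cats0.
have -> : foldl (fun r _ => tick :: r) [::] (bits x) = nseq n tick.
  have -> : n = n + 0 by rewrite addn0.
  rewrite -[RHS]foldl_push_nseq /= -Ex.
  by elim: (bits x) [::] => //= a s IH r; rewrite IH.
rewrite -(st_pad 2) /=.
apply: (run_seq (run_hornerc _ _ _ _ _ _ _)); rewrite -/(horner m n).
apply: run_seq.
  by apply: (run_le (run_mv _ _ _ _ _)) => //=; rewrite size_nseq.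
rewrite !upd_st /= catrevE rev_nseq !cats0.
apply: (run_seq (run_hornerc _ _ _ _ _ _ _)); rewrite -/(horner q n).
apply: run_seq.
  by apply: (run_le (run_clear _ _ _)); rewrite /= size_nseq.
rewrite !upd_st /=; apply: (run_seq (run_pushw _ _ _ _)); rewrite !upd_st /=.
apply: run_seq.
  apply: (run_le (run_xfer _ _ _ _ _ _ _ _ _ _ (size_enc_push 3))) => //.
  by rewrite /= size_nseq -addnA.
rewrite !upd_st /= catrevE rev_nseq !cats0.
apply: run_seq.
  by apply: (run_le (run_mv _ _ _ _ _)) => //=; rewrite size_nseq.
rewrite !upd_st /= catrevE rev_nseq !cats0.
apply: run_seq.
  apply: (run_le (run_xfer _ _ _ _ _ _ _ _ _ _ (size_enc_push 2))) => //.
  by rewrite /= size_rev Ex -addnA.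
rewrite !upd_st /= catrevE revK cats0.
apply: run_seq.
  by apply: (run_le (run_mv _ _ _ _ _)) => //=; rewrite Ex.
rewrite !upd_st /= catrevE cats0.
apply: run_seq; first by apply: run_ev.
rewrite /=; apply: run_seq.
  apply: (run_le (run_xfer _ _ _ _ _ 4 _ _ _ _ _)) => //.
  by rewrite /= size_nseq.
rewrite !upd_st /= catrevE rev_nseq !cats0.
apply: run_seq; first by apply: run_ev.
apply: (run_le (run_eq (run_mv _ _ _ _ _) _)) => //=; last by rewrite size_nseq.
rewrite !upd_st /= catrevE rev_nseq foldl_nseq4 foldl_rev.
(* A block of ticks is its own reverse, so this left fold too becomes the right fold of
   [enc_pushes]. *)
rewrite -[X in foldl _ W X]rev_nseq foldl_rev.
by rewrite -[X in _ =1 X](st_pad 3).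
Qed.

(** * Polynomial bounds *)

Definition poly_bounded (f : nat -> nat) : Prop :=
  exists p : {poly nat}, forall n, f n <= p.[n]%R.

Lemma poly_bounded_cst c : poly_bounded (fun=> c).
Proof. by exists c%:P%R => n; rewrite hornerC. Qed.

Lemma poly_bounded_id : poly_bounded (fun n => n).
Proof. by exists 'X%R => n; rewrite hornerX. Qed.

Lemma poly_bounded_add f g :
  poly_bounded f -> poly_bounded g -> poly_bounded (fun n => f n + g n).
Proof. by move=> [p Hp] [q Hq]; exists (p + q)%R => n; rewrite hornerD leq_add. Qed.

Lemma poly_bounded_mul f g :
  poly_bounded f -> poly_bounded g -> poly_bounded (fun n => f n * g n).
Proof. by move=> [p Hp] [q Hq]; exists (p * q)%R => n; rewrite hornerM leq_mul. Qed.

Lemma poly_bounded_succ f : poly_bounded f -> poly_bounded (fun n => (f n).+1).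
Proof.
move=> H; have [p Hp] := poly_bounded_add _ _ H (poly_bounded_cst 1).
by exists p => n; rewrite -addn1.
Qed.

Lemma poly_bounded_horner (p : {poly nat}) f :
  poly_bounded f -> poly_bounded (fun n => p.[f n]%R).
Proof.
move=> [q Hq]; exists (p \Po q)%R => n; rewrite horner_comp.
exact: horner_nat_le.
Qed.

Lemma poly_bounded_horner_rec (s : seq nat) : poly_bounded (horner_rec s).
Proof.
elim: s => [|a s IH]; first exact: poly_bounded_cst.
apply: (poly_bounded_add _ _ (poly_bounded_mul _ _ IH poly_bounded_id)).
exact: poly_bounded_cst.
Qed.

Ltac poly_bounded_tac := repeat first
  [ exact: poly_bounded_cst | exact: poly_bounded_id
  | exact: poly_bounded_horner_rec
  | apply: poly_bounded_succ | apply: poly_bounded_add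
  | apply: poly_bounded_mul | apply: poly_bounded_horner ].

Lemma poly_bounded_horner_time (s : seq nat) : poly_bounded (horner_time s).
Proof.
by elim: s => [|a s IH]; [exact: poly_bounded_cst | apply: poly_bounded_add => //];
  poly_bounded_tac.
Qed.

Lemma size_enc_pushes x w c :
  size (enc_cmd (pushes x w c)) <= size w * (size (bin x) + 8) + size (enc_cmd c).
Proof.
rewrite enc_pushes; elim: w => [//|a w IH]; rewrite /= size_cat mulSn.
by have := size_enc_push x a; lia.
Qed.

Definition instance_size (v : cmd) (n k m : nat) : nat :=
  m + (4 * m + (n * (size (bin 2) + 8) + (k * (size (bin 3) + 8) +
    size (enc_cmd (evalc v))))).+1.+1.

Lemma size_enc_instance v x k m :
  size (enc_instance m (4 * m) (utilc v x k)) <= instance_size v (size x) k m.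
Proof.
have := size_enc_pushes 2 (bits x) (pushes 3 (nseq k tick) (evalc v)).
have := size_enc_pushes 3 (nseq k tick) (evalc v).
rewrite /instance_size /enc_instance -/(utilc v x k).
move: (enc_cmd (evalc v)) (enc_cmd (pushes _ _ _)) (enc_cmd (utilc v x k)) => a b c.
have -> : size (bits x) = size x := size_map _ _.
by rewrite size_cat /= size_cat /= !size_nseq; lia.
Qed.

(** * The reduction and its correctness *)

Definition matching_size (m : nat) : nat := m * (4 * m) * (m + 4 * m + 2).

Definition reducec (v : cmd) (q m : {poly nat}) : cmd :=
  Seq (buildc v q m) (Seq (Query 0) (checkc v)).

Definition reduce_time (v : cmd) (p q m : {poly nat}) (n : nat) : nat :=
  build_time v q m n +
  ((instance_size v n q.[n]%R m.[n]%R + matching_size m.[n]%R).+1 +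
   check_time p n q.[n]%R (matching_size m.[n]%R)).

Lemma poly_bounded_reduce_time v p q m : poly_bounded (reduce_time v p q m).
Proof.
rewrite /reduce_time /build_time /instance_size /matching_size /check_time.
by poly_bounded_tac; apply: poly_bounded_horner_time.
Qed.

Lemma check_time_le p n k S S' : S <= S' -> check_time p n k S <= check_time p n k S'.
Proof. by move=> h; rewrite /check_time; nia. Qed.

Lemma runs_reducec O v V p q m x :
  (forall x w, runs no_oracle v [:: bits x; bits w]
                 p.[size x + size w]%R [:: Bit (V x w)]) ->
  let n := size x in
  let a := O (enc_instance m.[n]%R (4 * m.[n]%R) (utilc v x q.[n]%R)) in
  size a <= matching_size m.[n]%R ->
  runs O (reducec v q m) [:: bits x] (reduce_time v p q m n)
    [:: Bit (V x (decode q.[n]%R a))].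
Proof.
move=> Hv n a ha; have [s' E H] := run_checkc O _ _ _ x q.[n]%R a Hv.
suff [t lt Ht] : run O (reducec v q m) (st [:: bits x]) (reduce_time v p q m n) s'.
  by exists t, s'.
apply: run_seq; first exact: run_buildc.
apply: run_seq.
  eexists; last exact: ExecQuery.
  by rewrite ltnS leq_add // size_enc_instance.
by rewrite upd_st; apply: run_le H _; apply: check_time_le.
Qed.

Theorem theorem1 (R : realType) :
  exists p : {poly nat}, NP_hard (allocation R p).
Proof.
(* p is fixed before the language: the last summand m is to absorb every term of [util_time] that
   depends on the verifier, apart from the factor k, which is bounded by m. *)
have [p Hp] : poly_bounded (fun m =>
    m * (8 * matching_size m + 18) + (2 * matching_size m + m)).
  by rewrite /matching_size; poly_bounded_tac.
exists p => L [V [v [pv [q [Hv HL]]]]].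
(* These are the terms to absorb: n + 5n for loading and moving x, k for its ticks, the verifier,
   and 10 unit costs. In particular k <= m, so that all witnesses can be coded. *)
have [mp Hm] : poly_bounded (fun n => 6 * n + (q.[n]%R + (2 * pv.[n + q.[n]%R]%R + 10))).
  by poly_bounded_tac.
have [r Hr] := poly_bounded_reduce_time v pv q mp.
exists (reducec v q mp), r => O HO x.
pose n := size x; pose k := q.[n]%R; pose m := mp.[n]%R; pose u := utilc v x k.
have hm : 6 * n + (k + (2 * pv.[n + k]%R + 10)) <= m := Hm n.
pose inst := enc_instance m (4 * m) u.
pose U (M : perfect_matching m (4 * m)) : R := (V x (decode k (enc_matching M)))%:R%R.
have HU : computes_utility u U p.[m]%R.
  move=> M; exists (V x (decode k (enc_matching M)))%:R%R; first by rewrite ratr_nat.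
  have [t [s [H lt E]]] := runs_utilc no_oracle _ _ _ x k (enc_matching M) Hv.
  exists t, s; split=> //; apply: leq_trans lt (leq_trans _ (Hp m)).
  have hS : size (enc_matching M) <= matching_size m := size_enc_matching _ _ M.
  have km : k <= m by lia.
  have := leq_mul km (leqnn (8 * matching_size m + 18)).
  by rewrite /util_time -/n; have := check_time_le pv n k _ _ hS; rewrite /check_time; lia.
(* [solves] constrains the oracle only at words that have a solution, so a maximizer of U has to be
   exhibited first. *)
have /HO [m' [n' [U' [u' [Mopt [_ HU' /enc_instance_inj [Em En Eu] Hopt Eo]]]]]] :
    exists a, allocation R p inst a.
  suff [Mopt Hopt] : exists Mopt, forall M, (U M <= U Mopt)%R.
    by exists (enc_matching Mopt), m, (4 * m), U, u, Mopt; split=> //; lia.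
  (* U takes the values 0 and 1: a matching of value 1 is optimal, and if there is none, every
     matching is, such as the one coding the empty word. *)
  have U1 M : (U M <= 1)%R by rewrite /U lern1 leq_b1.
  case: (pickP (fun M : perfect_matching m (4 * m) => V x (decode k (enc_matching M)))).
    by move=> M0 H0; exists M0 => M; rewrite {2}/U H0.
  by move=> H0; exists (code_matching [::] m) => M; rewrite /U !H0.
subst m' n' u'.
(* The oracle's answer is optimal for some U' computed by the same program; determinism and
   injectivity of [enc_rat] identify U' with U. *)
have EU M : U' M = U M.
  have [r1 -> [t1 [s1 [H1 _ E1]]]] := HU' M; have [r2 -> [t2 [s2 [H2 _ E2]]]] := HU M.
  by congr ratr; apply: enc_rat_inj; rewrite -E1 -E2 (exec_det H1 H2).
have Ho : size (O inst) <= matching_size m by rewrite Eo; apply: size_enc_matching.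
exists (V x (decode k (O inst))).
  have [t [s [H lt E]]] := runs_reducec _ _ _ _ _ _ _ Hv Ho.
  by exists t, s; split=> //; apply: leq_trans lt (Hr n).
(* If the verifier accepts, the decoded word itself is the witness. *)
split=> [Vx|/HL [w hw Vw]].
  by apply/HL; exists (decode k (O inst)) => //; apply: size_decode.
(* Conversely, the matching coding a witness w has utility 1, so the optimal one has too and the
   verifier accepts. *)
have := Hopt (code_matching w m).
rewrite !EU /U decode_code_matching ?Vw ?ler_nat; last by apply/andP; split=> //; lia.
by rewrite -Eo; case: (V x _).
Qed.
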